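(* Let $X$ be a conditional set. For every conditional filter $\mathcal{F}$ on $X$ there exists a conditional ultrafilter $\mathcal{U}$ on $X$ such that $\mathcal{F}\sqsubseteq\mathcal{U}$.
   Context: $\mathcal{A}$ is a complete Boolean algebra with $0\neq1$; $p(a)$ is the set of families $(a_i)$ with $\bigvee a_i=a$, $a_i\wedge a_j=0$ for $i\ne j$. A conditional set $X=(X_a,\gamma_a)_{a\in\mathcal{A}}$ consists of sets $X_a$ and surjections $\gamma_a:X_1\to X_a$ ($X_0$ a singleton, $\gamma_1=\mathrm{id}$) which are consistent ($a\le b$, $\gamma_b(x)=\gamma_b(y)\Rightarrow\gamma_a(x)=\gamma_a(y)$) and stable (for $(a_i)\in p(1)$ and $x_i\in X_{a_i}$ there is a unique $x\in X_1$, written $\sum a_ix_i$, with $\gamma_{a_i}(x)=x_i$). Conditional subsets of $X$ living on $b$ correspond to non-empty subsets of $X_b$ closed under such gluings; $S(X)$ denotes the conditional subsets living on $1$, ordered by conditional inclusion $\sqsubseteq$ (for members of $S(X)$, $Y\sqsubseteq Z$ iff $Y_1\subseteq Z_1$), with conditional intersection $\sqcap$ (the infimum for $\sqsubseteq$ among all conditional subsets; $Y\sqcap Z$ lives on $\bigvee\{a: Y_a\cap Z_a\ne\emptyset\}$ with primal set the intersection there). For $(a_i)\in p(1)$ and $Y^i\in S(X)$, the gluing $\sum a_iY^i$ is the member of $S(X)$ with primal set $\{\sum a_iy_i: y_i\in Y^i_{a_i}\}$. A conditional filter on $X$ is a non-empty collection $\mathcal{F}\subseteq S(X)$ closed under gluings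 $\sum a_iY^i$ ($(a_i)\in p(1)$, $Y^i\in\mathcal{F}$) such that (i) $Z\in\mathcal{F}$ whenever $Z\in S(X)$ and $Y\sqsubseteq Z$ for some $Y\in\mathcal{F}$, and (ii) $Y\sqcap Z\in\mathcal{F}$ (in particular it lives on $1$) for all $Y,Z\in\mathcal{F}$. For conditional filters, $\mathcal{F}\sqsubseteq\mathcal{F}'$ means $\mathcal{F}\subseteq\mathcal{F}'$; a conditional ultrafilter is a conditional filter maximal with respect to $\sqsubseteq$. *)

(* Defs.v *)
From HB Require Import structures.
From mathcomp Require Import all_boot all_order.
From mathcomp Require Import boolp classical_sets.

Set Implicit Arguments.
Unset Strict Implicit.
Unset Printing Implicit Defensive.

Import Order.Theory.
Local Open Scope classical_set_scope.
Local Open Scope order_scope.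

HB.mixin Record isCompleteBoolean d T of Order.CTBDistrLattice d T := {
  isLub_ex : forall S : set T, exists m, isLub S m;
  bot_neq_top : (\bot : T) <> \top
}.

#[short(type="completeBooleanType")]
HB.structure Definition CompleteBoolean d :=
  {T of isCompleteBoolean d T & Order.CTBDistrLattice d T}.

Section CompleteBooleanTheory.
Context {d : Order.disp_t} {A : completeBooleanType d}.
Implicit Types (a b c : A) (D : set A).

Definition bigjoin D : A := supremum \bot D.

Lemma bigjoinP D : isLub D (bigjoin D).
Proof.
rewrite /bigjoin /supremum; case: ifPn => [/eqP ->|_].
  by split=> [x //|b _]; exact: le0x.
have [m [m1 m2]] := isLub_ex D.
have mP : supremums D m by split.
by have [s1 s2] := xgetPex \bot (ex_intro _ m mP); split.
Qed.

(* [cpartition b a] is (a_i) \in p(b); zero members are allowed, and the index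
   type is arbitrary. *)
Definition cpartition b (I : Type) (a : I -> A) : Prop :=
  isLub (range a) b /\ forall i j, i <> j -> a i `&` a j = \bot.

Lemma cpartition_le b I (a : I -> A) i : cpartition b a -> a i <= b.
Proof. by case=> -[h _] _; apply: h; exists i. Qed.

Lemma cpartition_meet b I (a : I -> A) c :
  cpartition b a -> c <= b -> cpartition c (fun i => c `&` a i).
Proof.
case=> -[ub lub] dis cb; split; first split.
- by move=> _ [i _ <-]; exact: leIl.
- move=> u hu.
  have : b <= ~` c `|` u.
    apply: lub => _ [i _ <-]; rewrite -leBLR diffE complK meetC.
    by apply: hu; exists i.
  by move=> /(le_trans cb); rewrite -leBLR diffE complK meetxx.
- by move=> i j /dis h; rewrite meetACA h meetx0.
Qed.

Definition extend_family I (a : I -> A) c (o : option I) := if o is Some i then a i else c.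

Lemma cpartition_extend b c I (a : I -> A) :
  cpartition c a -> c <= b -> cpartition b (extend_family a (b `\` c)).
Proof.
move=> pa cb; case: (pa) => -[ub lub] dis.
have disN i : a i `&` (b `\` c) = \bot.
  by rewrite -(meet_idPl (cpartition_le i pa)) meetIB.
split; first split.
- by move=> _ [[i|] _ <-] /=; [exact: le_trans (cpartition_le i pa) cb|exact: leBx].
- move=> u hu; rewrite -(leBUK cb) leUx.
  apply/andP; split; first by apply: hu; exists None.
  by apply: lub => _ [i _ <-]; apply: hu; exists (Some i).
- move=> [i|] [j|] //= ij; last by rewrite meetC.
  by apply: dis => e; apply: ij; rewrite e.
Qed.

Lemma cpartition_sup D : (forall a b, a <= b -> D b -> D a) ->
  exists (I : Type) (a : I -> A), cpartition (bigjoin D) a /\ forall i, D (a i).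
Proof.
move=> down.
pose P (B : set A) := B `<=` D /\ forall x y, B x -> B y -> x <> y -> x `&` y = \bot.
have [|B [[BD Bdis] Bmax]] := @Zorn_bigcup A P.
  move=> F FP tot; split=> [x [X /FP[XD _] /XD //]|x y [X FX Xx] [Y FY Yy]].
  by have [XY|YX] := tot _ _ FX FY;
    [apply: (FP _ FY).2 => //; exact: XY|apply: (FP _ FX).2 => //; exact: YX].
exists {x | B x}, (fun x => sval x); split; last by move=> [x /= /BD].
have [sub slub] := bigjoinP D.
split; first split.
- by move=> _ [[x Bx] _ <-] /=; apply/sub/BD.
- move=> u hu; apply: slub => e De.
  have Bu x : B x -> x <= u by move=> Bx; apply: hu; exists (exist _ x Bx).
  pose f := e `\` u.
  have fx x : B x -> f `&` x = \bot.
    by move=> /Bu xu; rewrite -(meet_idPl xu) /f meetBI.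
  have Df : D f by apply: down De; exact: leBx.
  have [Bf|nBf] := pselect (B f).
    have f0 : f = \bot by rewrite -(fx _ Bf) meetxx.
    by move/eqP: f0; rewrite -lex0 leBLR joinx0.
  case: (Bmax [set x | B x \/ x = f]).
    split=> [x|/(_ f)]; first by left.
    by move=> /(_ (or_intror erefl)).
  split=> [x [/BD//|->//]|x y [Bx|->] [By|->] // xy].
  + exact: Bdis.
  + by rewrite meetC fx.
  + by rewrite fx.
- move=> [x Bx] [y By] xy /=; apply: Bdis => // exy; apply: xy.
  by apply: eq_exist.
Qed.

End CompleteBooleanTheory.

(* [stable] provides existence and uniqueness of the gluing \sum a_i x_i. *)
Record condSet d (A : completeBooleanType d) := CondSet {
  carrier :> A -> Type;
  gamma : forall a, carrier \top -> carrier a;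
  gamma_surj : forall a (y : carrier a), exists x, gamma a x = y;
  carrier_bot : exists x : carrier \bot, forall y, y = x;
  gamma_top : forall x, gamma \top x = x;
  consistent : forall a b x y, a <= b -> gamma b x = gamma b y ->
    gamma a x = gamma a y;
  stable : forall (I : Type) (a : I -> A), cpartition \top a ->
    forall x : forall i, carrier (a i),
    exists! z, forall i, gamma (a i) z = x i
}.
Arguments gamma {d A} c a.

Section ConditionalSets.
Context {d : Order.disp_t} {A : completeBooleanType d} (X : condSet A).
Implicit Types (a b c : A).

Definition glue I (a : I -> A) (pa : cpartition \top a) (x : forall i, X (a i)) :
  X \top := sval (cid (stable pa x)).

Lemma glueE I (a : I -> A) (pa : cpartition \top a) (x : forall i, X (a i)) i :
  gamma X (a i) (glue pa x) = x i.
Proof. by rewrite /glue; case: cid => z /= []. Qed.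

Lemma gamma_inj I (a : I -> A) : cpartition \top a -> forall x y : X \top,
  (forall i, gamma X (a i) x = gamma X (a i) y) -> x = y.
Proof.
move=> pa x y xy; have [z [_ zu]] := stable pa (fun i => gamma X (a i) x).
by rewrite -(zu x) // -(zu y).
Qed.

(* The map X_b -> X_a induced by consistency; only meaningful for a <= b, where
   it does not depend on the chosen preimage (lemma [restr_gamma]). *)
Definition restr b a (x : X b) : X a := gamma X a (sval (cid (gamma_surj x))).

Lemma restr_gamma b a (x : X \top) : a <= b -> restr a (gamma X b x) = gamma X a x.
Proof. by move=> ab; rewrite /restr; case: cid => y /= /(consistent ab). Qed.

Lemma restr_id b (x : X b) : restr b x = x.
Proof. by rewrite /restr; case: cid. Qed.

Lemma restr_restr a b c (x : X c) : a <= b -> b <= c ->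
  restr a (restr b x) = restr a x.
Proof.
move=> ab bc; have [y <-] := gamma_surj x.
by rewrite !restr_gamma // (le_trans ab).
Qed.

Lemma restr_top a (x : X \top) : restr a x = gamma X a x.
Proof. by rewrite -{1}(gamma_top x) restr_gamma // lex1. Qed.

Lemma restr_stable b I (a : I -> A) (x : forall i, X (a i)) :
  cpartition b a -> exists! z : X b, forall i, restr (a i) z = x i.
Proof.
move=> pa.
have pe : cpartition \top (extend_family a (\top `\` b)) by apply: cpartition_extend; rewrite ?lex1.
have ab i := cpartition_le i pa.
have [x0 _] := carrier_bot X; have [y0 _] := gamma_surj x0.
pose xe (o : option I) : X (extend_family a (\top `\` b) o) :=
  match o with Some i => x i | None => gamma X _ y0 end.
exists (gamma X b (glue pe xe)); split=> [i|z zx].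
  by rewrite restr_gamma //; exact: (glueE pe xe (Some i)).
have [z' z'z] := gamma_surj z; rewrite -{}z'z in zx *.
pose ye (o : option I) : X (extend_family a (\top `\` b) o) :=
  match o with Some i => x i | None => gamma X _ z' end.
have <- : glue pe ye = z'.
  apply: (gamma_inj pe) => o; rewrite glueE; case: o => [i|] //=.
  by rewrite -zx restr_gamma.
have pb : cpartition \top (extend_family (fun _ : unit => b) (\top `\` b)).
  apply: cpartition_extend; last exact: lex1.
  by split; [split=> [_ [_ _ <-]//|u]; apply; exists tt|move=> [] []].
pose we (o : option unit) : X (extend_family (fun _ : unit => b) (\top `\` b) o) :=
  match o with Some _ => gamma X b (glue pe xe)
             | None => gamma X (\top `\` b) z' end.
have wE : glue pb we = glue pe ye.
  apply: (gamma_inj pe) => -[i|]; rewrite glueE /=.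
    rewrite -(restr_gamma _ (ab i)) (glueE pb we (Some tt)) /=.
    by rewrite restr_gamma // (glueE pe xe (Some i)).
  exact: (glueE pb we None).
by rewrite -wE (glueE pb we (Some tt)).
Qed.

Lemma restr_inj b I (a : I -> A) : cpartition b a -> forall x y : X b,
  (forall i, restr (a i) x = restr (a i) y) -> x = y.
Proof.
move=> pa x y xy; have [z [_ zu]] := restr_stable (fun i => restr (a i) x) pa.
by rewrite -(zu x) // -(zu y).
Qed.

Definition glue_closed b (S : set (X b)) : Prop :=
  forall (I : Type) (a : I -> A), cpartition b a ->
  forall (y : I -> X b) (x : X b), (forall i, S (y i)) ->
    (forall i, restr (a i) x = restr (a i) (y i)) -> S x.

Record condSubset := CondSubset {
  lives_on : A;
  primal : set (X lives_on);
  primal_nonempty : primal !=set0;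
  primal_closed : glue_closed primal
}.
Arguments primal : clear implicits.
Arguments primal_nonempty : clear implicits.
Implicit Types (Y Z W : condSubset).

(* Y_a; only meaningful for a <= lives_on Y. *)
Definition fiber Y a : set (X a) := restr a @` primal Y.
Arguments fiber : clear implicits.

Lemma fiber_lives_on Y : fiber Y (lives_on Y) = primal Y.
Proof.
apply/seteqP; split=> [_ [y Yy <-]|y Yy]; first by rewrite restr_id.
by exists y => //; exact: restr_id.
Qed.

Lemma fiber_nonempty Y a : fiber Y a !=set0.
Proof. by have [y Yy] := primal_nonempty Y; exists (restr a y), y. Qed.

Lemma fiber_restr Y a b (x : X b) : a <= b -> b <= lives_on Y ->
  fiber Y b x -> fiber Y a (restr a x).
Proof. by move=> ab bY [y Yy <-]; exists y => //; rewrite restr_restr. Qed.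

Lemma fiber_closed Y b : b <= lives_on Y -> glue_closed (fiber Y b).
Proof.
move=> bY I a pa y x Sy xy.
have ab i := cpartition_le i pa.
have pe := cpartition_extend pa bY.
have [y0 Yy0] := primal_nonempty Y.
have /choice[z zP] : forall i, exists z, primal Y z /\ restr b z = y i.
  by move=> i; have [z Yz zy] := Sy i; exists z.
pose ze (o : option I) : X (lives_on Y) := if o is Some i then z i else y0.
have [w [wE _]] := restr_stable (fun o => restr _ (ze o)) pe.
exists w; first by apply: (primal_closed pe _ wE) => -[i|] //=; exact: (zP i).1.
apply: (restr_inj pa) => i; rewrite restr_restr // (wE (Some i)) /= xy.
by rewrite -(zP i).2 restr_restr.
Qed.

Lemma fiber_surj Y a b (x : X a) : a <= b -> b <= lives_on Y ->
  fiber Y a x -> exists2 z, fiber Y b z & restr a z = x.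
Proof.
move=> ab bY [y Yy <-]; exists (restr b y); first by exists y.
exact: restr_restr.
Qed.

Definition csub Y Z : Prop :=
  lives_on Y <= lives_on Z /\ primal Y `<=` fiber Z (lives_on Y).

(* S(X), as a subset of all conditional subsets rather than as a separate type. *)
Definition onTop : set condSubset := [set Y | lives_on Y = \top].

Lemma csub_onTop Y Z : onTop Y -> onTop Z ->
  csub Y Z <-> fiber Y \top `<=` fiber Z \top.
Proof.
rewrite /onTop /= /csub -(fiber_lives_on Y) => -> ->.
by rewrite lexx; split=> [[]|].
Qed.

Section Gluing.
Variables (I : Type) (a : I -> A) (pa : cpartition \top a).
Variables (Y : I -> condSubset) (tY : forall i, onTop (Y i)).

Definition glue_primal : set (X \top) :=
  [set z | exists2 y : forall i, X (a i),
    (forall i, fiber (Y i) (a i) (y i)) & z = glue pa y].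

Lemma glue_primalP z :
  glue_primal z <-> forall i, fiber (Y i) (a i) (gamma X (a i) z).
Proof.
split=> [[y Yy -> i]|Yz]; first by rewrite glueE.
exists (fun i => gamma X (a i) z) => //.
by apply: (gamma_inj pa) => i; rewrite glueE.
Qed.

Lemma glue_primal_nonempty : glue_primal !=set0.
Proof.
pose y i := sval (cid (fiber_nonempty (Y i) (a i))).
by exists (glue pa y), y => // i; rewrite /y; case: cid.
Qed.

Lemma glue_primal_closed : glue_closed glue_primal.
Proof.
move=> J b pb x z xP zx; apply/glue_primalP => i.
have aY : a i <= lives_on (Y i) by rewrite tY lex1.
have pab := cpartition_meet pb (lex1 (a i)).
apply: (fiber_closed aY pab (y := fun j => gamma X (a i) (x j))).
  by move=> j; have /glue_primalP := xP j.
move=> j; have le : a i `&` b j <= b j := leIr _ _.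
rewrite !restr_gamma ?leIl // -(restr_gamma z le) -(restr_gamma (x j) le).
by rewrite -!restr_top zx.
Qed.

Definition glueSub : condSubset :=
  CondSubset glue_primal_nonempty glue_primal_closed.

End Gluing.

Section Intersection.
Variables Y Z : condSubset.

Definition cap_dom : set A :=
  [set a | [/\ a <= lives_on Y, a <= lives_on Z
             & exists x, fiber Y a x /\ fiber Z a x]].

Definition cap_lives_on : A := bigjoin cap_dom.

Definition cap_primal : set (X cap_lives_on) :=
  [set x | fiber Y cap_lives_on x /\ fiber Z cap_lives_on x].

Lemma cap_lives_on_le : cap_lives_on <= lives_on Y /\ cap_lives_on <= lives_on Z.
Proof.
have [_ lub] := bigjoinP cap_dom.
by split; apply: lub => a [].
Qed.

Lemma cap_primal_nonempty : cap_primal !=set0.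
Proof.
have [cY cZ] := cap_lives_on_le.
have [|I [a [pa aD]]] := @cpartition_sup _ _ cap_dom.
  move=> a b ab [bY bZ [x [Yx Zx]]]; split; rewrite ?(le_trans ab) //.
  by exists (restr a x); split; apply: fiber_restr ab _ _.
rewrite -/cap_lives_on in pa.
have ac i := cpartition_le i pa.
have xP i : exists x, fiber Y (a i) x /\ fiber Z (a i) x by case: (aD i).
have [x [xE _]] := restr_stable (fun i => sval (cid (xP i))) pa.
exists x; split.
- have /choice[y yP] : forall i, exists y, fiber Y cap_lives_on y /\
      restr (a i) y = sval (cid (xP i)).
    move=> i; case: cid => t /= [Yt _].
    by have [y ? ?] := fiber_surj (ac i) cY Yt; exists y.
  by apply: (fiber_closed cY pa (y := y)) => i; [case: (yP i)|rewrite xE (yP i).2].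
- have /choice[y yP] : forall i, exists y, fiber Z cap_lives_on y /\
      restr (a i) y = sval (cid (xP i)).
    move=> i; case: cid => t /= [_ Zt].
    by have [y ? ?] := fiber_surj (ac i) cZ Zt; exists y.
  by apply: (fiber_closed cZ pa (y := y)) => i; [case: (yP i)|rewrite xE (yP i).2].
Qed.

Lemma cap_primal_closed : glue_closed cap_primal.
Proof.
have [cY cZ] := cap_lives_on_le.
move=> I a pa y x yP xy; split.
- by apply: (fiber_closed cY pa (y := y)) => // i; case: (yP i).
- by apply: (fiber_closed cZ pa (y := y)) => // i; case: (yP i).
Qed.

Definition csetI : condSubset := CondSubset cap_primal_nonempty cap_primal_closed.

End Intersection.

Lemma csetI_infimum Y Z : [/\ csub (csetI Y Z) Y, csub (csetI Y Z) Z
  & forall W, csub W Y -> csub W Z -> csub W (csetI Y Z)].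
Proof.
have [cY cZ] := cap_lives_on_le Y Z.
split; [by split=> // x []|by split=> // x []|move=> W [wY WY] [wZ WZ]].
have wc : lives_on W <= cap_lives_on Y Z.
  apply: (bigjoinP (cap_dom Y Z)).1; split=> //.
  by have [x Wx] := primal_nonempty W; exists x; split; [exact: WY|exact: WZ].
split=> // x Wx.
have p1 : cpartition (lives_on W) (fun _ : unit => lives_on W).
  by split; [split=> [_ [_ _ <-]//|u]; apply; exists tt|move=> [] []].
have pe := cpartition_extend p1 wc.
have [v [Yv Zv]] := cap_primal_nonempty Y Z.
have [y Yy yx] := fiber_surj wc cY (WY _ Wx).
have [z Zz zx] := fiber_surj wc cZ (WZ _ Wx).
pose ye (o : option unit) := if o is Some _ then y else v.
pose ze (o : option unit) := if o is Some _ then z else v.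
have [t [tE _]] := restr_stable (fun o => restr _ (ye o)) pe.
exists t; last by rewrite (tE (Some tt)).
split.
- by apply: (fiber_closed cY pe (y := ye)) => // -[[]|].
- apply: (fiber_closed cZ pe (y := ze)) => [[[]|] //|[[]|]].
    by rewrite (tE (Some tt)) /= yx zx.
  by rewrite (tE None).
Qed.

Implicit Types F U : set condSubset.

Definition cond_filter F : Prop :=
  [/\ F !=set0,
      F `<=` onTop,
      forall (I : Type) (a : I -> A) (pa : cpartition \top a)
        (Y : I -> condSubset) (tY : forall i, onTop (Y i)),
        (forall i, F (Y i)) -> F (glueSub pa tY),
      forall Y Z, F Y -> onTop Z -> csub Y Z -> F Z
    & forall Y Z, F Y -> F Z -> F (csetI Y Z)].

Definition cond_ultrafilter U : Prop :=
  cond_filter U /\ forall F, cond_filter F -> U `<=` F -> F = U.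

End ConditionalSets.

Arguments lives_on {d A X} c.
Arguments primal {d A X} c.
Arguments fiber {d A X} Y a.
Arguments primal_nonempty {d A X} c.

(* Main.v *)
Require Import Defs.
From mathcomp Require Import all_boot all_order.
From mathcomp Require Import boolp classical_sets.

(** Unions of chains of conditional filters need not be closed under infinite
    gluings, so they are not upper bounds in Zorn's lemma.  The upper bound used
    instead consists of the [Z] that contain some member of the union locally,
    on a family of conditions [a] with supremum 1.  Two members of the union lie
    in a common filter of the chain, so their intersection lives on 1; this is
    why the local inclusions for [Z] and [Z'] yield, on each [a `&` a'], a point
    common to [Z] and [Z'], and hence why [csetI Z Z'] lives on 1. *)

Local Open Scope classical_set_scope.
Import Order.Theory.
Local Open Scope order_scope.

Section FilterHull.
Set Implicit Arguments.
Unset Strict Implicit.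
Context {d : Order.disp_t} {A : completeBooleanType d} {X : condSet A}.
Implicit Types (a b c u : A) (Y Z : condSubset X) (B : set (condSubset X)).

Lemma onTop_le Y a : onTop Y -> a <= lives_on Y.
Proof. by rewrite /onTop /= => ->; exact: lex1. Qed.

Lemma fiber_subset_le Y Z a c : onTop Y -> onTop Z -> c <= a ->
  fiber Y a `<=` fiber Z a -> fiber Y c `<=` fiber Z c.
Proof.
move=> tY tZ ca YZ x Yx.
have [z Yz <-] := fiber_surj ca (onTop_le _ tY) Yx.
by apply: fiber_restr ca (onTop_le _ tZ) _; exact: YZ.
Qed.

Lemma csub_fiber Y Z a : a <= lives_on Y -> csub Y Z -> fiber Y a `<=` fiber Z a.
Proof.
move=> aY [YZ sYZ] _ [y Yy <-].
by apply: (fiber_restr aY YZ); exact: sYZ.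
Qed.

(** The restriction of [Y] to the condition [a]. The infimum property of [csetI] can be tested on
    it, since that property ranges over conditional subsets living on any condition. *)
Definition fiberSub Y a (aY : a <= lives_on Y) : condSubset X :=
  CondSubset (fiber_nonempty Y a) (fiber_closed aY).

(** A point of [Y i] over [c] lifts to [a i] and is glued with arbitrary points at the other
    indices. The clause [j = i -> restr c y = x] selects the lift without transport between the
    types [X (a j)]. *)
Lemma fiber_glueSub I (a : I -> A) (pa : cpartition \top a)
    (Y : I -> condSubset X) (tY : forall i, onTop (Y i)) i c :
  c <= a i -> fiber (Y i) c `<=` fiber (glueSub pa tY) c.
Proof.
move=> ci x Yx.
have [z Yz zx] := fiber_surj ci (onTop_le (a i) (tY i)) Yx.
have yP j : exists y : X (a j), fiber (Y j) (a j) y /\ (j = i -> restr c y = x).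
  have [->|ne] := pselect (j = i); first by exists z.
  by have [y Yy] := fiber_nonempty (Y j) (a j); exists y.
pose y j := sval (cid (yP j)).
exists (glue pa y).
  by exists y => // j; rewrite /y; case: (cid (yP j)) => ? [].
rewrite restr_top -(restr_gamma (glue pa y) ci) glueE /y.
by case: (cid (yP i)) => ? [_ ->].
Qed.

Definition local_csub B Z : set A :=
  [set a | exists2 Y, B Y & fiber Y a `<=` fiber Z a].

(** Since [\top] bounds everything, the second clause says that [local_csub B Z] has supremum
    [\top]; no disjoint family has to be chosen. *)
Definition filter_hull B : set (condSubset X) :=
  [set Z | onTop Z /\ forall u, ubound (local_csub B Z) u -> u = \top].

Lemma sub_filter_hull B : B `<=` @onTop _ _ X -> B `<=` filter_hull B.
Proof.
move=> tB Y BY; split; first exact: tB.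
by move=> u hu; apply/eqP; rewrite -le1x; apply: hu; exists Y.
Qed.

(** The Heyting adjunction; it stands in for infinite distributivity below. *)
Lemma le_residual a b u : (a `&` b <= u) = (b <= ~` a `|` u).
Proof. by rewrite -leBLR diffE complK meetC. Qed.

Lemma ubound_meet_top (D D' : set A) u :
  (forall v, ubound D v -> v = \top) -> (forall v, ubound D' v -> v = \top) ->
  (forall a b, D a -> D' b -> a `&` b <= u) -> u = \top.
Proof.
move=> hD hD' hu; apply: hD => a Da.
have : ~` a `|` u = \top by apply: hD' => b Db; rewrite -le_residual; exact: hu.
by move=> e; rewrite -(meetx1 a) le_residual e.
Qed.

Lemma cond_filter_hull B : B !=set0 -> B `<=` @onTop _ _ X ->
  (forall Y Y', B Y -> B Y' -> B (csetI Y Y')) -> cond_filter (filter_hull B).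
Proof.
move=> [Y0 BY0] tB capB; split.
- by exists Y0; exact: sub_filter_hull.
- by move=> Z [].
- move=> I a pa Z tZ hZ; split=> // u hu.
  have [[_ lub] _] := pa.
  apply/eqP; rewrite -le1x; apply: lub => _ [i _ <-].
  rewrite -(meetx1 (a i)) le_residual.
  rewrite ((hZ i).2 (~` a i `|` u)) // => b [Y BY YZ].
  rewrite -le_residual; apply: hu; exists Y => //.
  apply: subset_trans _ (fiber_glueSub pa tZ (leIl _ _)).
  by apply: fiber_subset_le YZ; [exact: tB|exact: tZ|exact: leIr].
- move=> Z Z' [tZ hZ] tZ' ZZ'; split=> // u hu; apply: hZ => a [Y BY YZ].
  apply: hu; exists Y => //.
  by apply: subset_trans YZ (csub_fiber (onTop_le _ tZ) ZZ').
- move=> Z Z' [tZ hZ] [tZ' hZ'].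
  have key a b : local_csub B Z a -> local_csub B Z' b ->
      a `&` b <= lives_on (csetI Z Z') /\ local_csub B (csetI Z Z') (a `&` b).
    move=> [Y BY YZ] [Y' BY' YZ'].
    have BYY' := capB _ _ BY BY'; have tYY' := tB _ BYY'.
    have [cY cY' _] := csetI_infimum Y Y'.
    have [_ _ inf] := csetI_infimum Z Z'.
    have le := onTop_le (a `&` b) tYY'.
    (* Being below [csetI Z Z'] gives both claims at once: the bound on the condition it lives on,
       and the local inclusion. *)
    suff [? ?] : csub (fiberSub le) (csetI Z Z').
      by split=> //; exists (csetI Y Y').
    apply: inf; split => /=; rewrite ?(onTop_le _ tZ) ?(onTop_le _ tZ') //.
      apply: subset_trans (csub_fiber le cY) _.
      by apply: fiber_subset_le YZ; [exact: tB|exact: tZ|exact: leIl].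
    apply: subset_trans (csub_fiber le cY') _.
    by apply: fiber_subset_le YZ'; [exact: tB|exact: tZ'|exact: leIr].
  split.
    by apply: (ubound_meet_top hZ hZ') => a b Da Db; have [] := key a b Da Db.
  move=> u hu; apply: (ubound_meet_top hZ hZ') => a b Da Db.
  by apply: hu; have [] := key a b Da Db.
Qed.

Lemma cond_filter_chain_ub (C : set (set (condSubset X))) :
  C !=set0 -> (forall G, C G -> cond_filter G) ->
  (forall G G', C G -> C G' -> G `<=` G' \/ G' `<=` G) ->
  exists H, cond_filter H /\ forall G, C G -> G `<=` H.
Proof.
move=> [G0 CG0] fC totC; pose B := \bigcup_(G in C) G.
have tB : B `<=` @onTop _ _ X by move=> Y [G /fC[_ tG _ _ _]]; exact: tG.
exists (filter_hull B); split.
  apply: cond_filter_hull => //.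
    by have [[Y GY] _ _ _ _] := fC _ CG0; exists Y, G0.
  move=> Y Y' [G CG GY] [G' CG' GY'].
  have [_ _ _ _ capG] := fC _ CG; have [_ _ _ _ capG'] := fC _ CG'.
  by have [s|s] := totC _ _ CG CG'; [exists G' => //; apply: capG' => //; exact: s
    |exists G => //; apply: capG => //; exact: s].
by move=> G CG Y GY; apply: (sub_filter_hull tB); exists G.
Qed.

End FilterHull.

Local Close Scope order_scope.

Theorem theorem2p24 (d : Order.disp_t) (A : completeBooleanType d)
    (X : condSet A) (F : set (condSubset X)) (hF : cond_filter F) :
  exists U : set (condSubset X), cond_ultrafilter U /\ F `<=` U.
Proof.
(* Maximality in [T] is maximality among all filters, since a filter above a member of [T] contains
   [F]. *)
pose T := {G : set (condSubset X) | cond_filter G /\ F `<=` G}.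
pose R (G H : T) := `[< sval G `<=` sval H >].
have [|G H K /asboolP GH /asboolP HK|[G pG] [H pH] /asboolP/= GH /asboolP/= HG
  |C totC|[U [fU FU]] Umax] := @Zorn T R.
- by move=> G; apply/asboolP.
- by apply/asboolP; exact: subset_trans GH HK.
- by apply: eq_exist; apply/seteqP.
(* The empty chain is bounded by [F] itself. *)
- have [[G0 CG0]|C0] := pselect (C !=set0); last first.
    by exists (exist _ F (conj hF (@subset_refl _ F))) => G CG; case: C0; exists G.
  have [||_ _ [G CG <-] [G' CG' <-]|H [fH CH]] :=
      cond_filter_chain_ub (C := [set sval G | G in C]).
  + by exists (sval G0), G0.
  + by move=> _ [G CG <-]; have [] := svalP G.
  + by have [/asboolP|/asboolP] := totC _ _ CG CG'; [left|right].
  have FH : F `<=` H.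
    by apply: subset_trans (svalP G0).2 (CH _ _); exists G0.
  by exists (exist _ H (conj fH FH)) => G CG; apply/asboolP/CH; exists G.
exists U; split=> //; split=> // G fG UG.
have FG := subset_trans FU UG.
have /(congr1 sval) // : exist _ G (conj fG FG) = exist _ U (conj fU FU) :> T.
by apply: Umax; apply/asboolP.
Qed.
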